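(* Let $p$ be a probability distribution over the joint assignments to a finite set $\mathcal{V}$ of discrete random variables, let $sq$ be a probability distribution over the set of legal statistical queries over $\mathcal{V}$, and let $B$ be a fixed Bayesian net over $\mathcal{V}$. Let $0<\epsilon,\delta<1$ and suppose there is a known $\lambda>0$ such that every query $(\mathbf{x};\mathbf{y})$ that can be encountered (i.e. with $sq(\mathbf{x};\mathbf{y})>0$) satisfies $p(\mathbf{y})\geq\lambda$. Let $$M_{SQ}=\left\lceil\frac{2}{\epsilon^2}\ln\frac{4}{\delta}\right\rceil,\qquad M'_D=\frac{8}{\epsilon^2}\ln\frac{2M_{SQ}}{\delta},$$ $$M_D=M_D(\epsilon,\delta,\lambda)=\left\lceil\max\left\{\frac{2}{\lambda}\left[M'_D+\ln\frac{4M_{SQ}}{\delta}\right],\ \frac{8}{\epsilon^2}\ln\frac{4M_{SQ}}{\delta}\right\}\right\rceil .$$ Let $S_{SQ}$ be a sample of $M_{SQ}$ unlabeled queries drawn independently from $sq$, and let $S_D$ be a sample of $M_D$ complete examples (full assignments to $\mathcal{V}$) drawn independently from $p$. Let $$\overline{\mathrm{err}}^{S_{SQ},S_D}(B)=\frac{1}{|S_{SQ}|}\sum_{\langle\mathbf{x},\mathbf{y}\rangle\in S_{SQ}}\left[B(\mathbf{x}\mid\mathbf{y})-\hat p^{(S_D)}(\mathbf{x}\mid\mathbf{y})\right]^2,$$ where $\hat p^{(S_D)}(\mathbf{x}\mid\mathbf{y})$ is the empirical estimate of $p(\mathbf{x}\mid\mathbf{y})$ based on $S_D$. Then $$P\left[\,\left|\overline{\mathrm{err}}^{S_{SQ},S_D}(B)-\mathrm{err}(B)\right|<\epsilon\,\right]\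 \geq\ 1-\delta .$$
   Context: $\mathcal{V}=\{V_1,\dots,V_N\}$ is a finite set of random variables, each with a finite domain, with a fixed underlying joint distribution $p$. A (legal) statistical query is a pair $(\mathbf{X}=\mathbf{x};\mathbf{Y}=\mathbf{y})$, abbreviated $(\mathbf{x};\mathbf{y})$, where $\mathbf{X},\mathbf{Y}\subset\mathcal{V}$ are disjoint (possibly empty) subsets, $\mathbf{x},\mathbf{y}$ are assignments to them, and $p(\mathbf{Y}=\mathbf{y})>0$; it asks for the value $p(\mathbf{x}\mid\mathbf{y})=p(\mathbf{X}=\mathbf{x}\mid\mathbf{Y}=\mathbf{y})$. $sq(\mathbf{x};\mathbf{y})$ denotes the probability, under $sq$, that the query is asked; $sq$ need not be related to $p$. An example matches $\mathbf{y}$ if it assigns the values $\mathbf{y}$ to the variables $\mathbf{Y}$; the empirical estimate $\hat p^{(S_D)}(\mathbf{x}\mid\mathbf{y})$ is the fraction, among the examples in $S_D$ that match $\mathbf{y}$, of those that also match $\mathbf{x}$ (an arbitrary value in $[0,1]$ if no example matches $\mathbf{y}$). A Bayesian net $B$ over $\mathcal{V}$ is a directed acyclic graph on $\mathcal{V}$ with a conditional probability table for each node given its parents; $B(\mathbf{x}\mid\mathbf{y})\in[0,1]$ denotes the conditional probability that $B$ returns for the query. The score (error) of $B$ is $$\mathrm{err}(B)=\sum_{\mathbf{x},\mathbf{y}} sq(\mathbf{x};\mathbf{y})\,[B(\mathbf{x}\mid\mathbf{y})-p(\mathbf{x}\mid\mathbf{y})]^2,$$ the sum being over all assignments to all (disjoint)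 subsets $\mathbf{X},\mathbf{Y}$ of variables. *)

(* Defs.v *)
(* MathComp; MathComp-Analysis supplies the reals and the logarithm. *)
From HB Require Import structures.
From mathcomp Require Import all_boot all_order all_algebra.
From mathcomp Require Import reals exp.

Set Implicit Arguments.
Unset Strict Implicit.
Unset Printing Implicit Defensive.

Import Order.TTheory GRing.Theory Num.Theory.
Local Open Scope ring_scope.

Record fdist (R : realType) (T : finType) := FDist {
  pmf :> T -> R;
  pmf_ge0 : forall t, 0 <= pmf t;
  pmf_sum1 : \sum_(t : T) pmf t = 1 }.

Definition Pr (R : realType) (T : finType) (d : T -> R) (E : pred T) : R :=
  \sum_(t : T | E t) d t.

Section Products.
Variable R : realType.

Section Iid.
Variables (T : finType) (n : nat) (d : fdist R T).

Definition iid_pmf (s : {ffun 'I_n -> T}) : R := \prod_(i < n) d (s i).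

Fact iid_pmf_ge0 s : 0 <= iid_pmf s.
Proof. by apply: prodr_ge0 => i _; exact: pmf_ge0. Qed.

Fact iid_pmf_sum1 : \sum_s iid_pmf s = 1.
Proof.
rewrite /iid_pmf -(bigA_distr_bigA (fun (_ : 'I_n) (t : T) => d t)) /=.
by rewrite big1 // => i _; exact: pmf_sum1.
Qed.

Definition iid : fdist R {ffun 'I_n -> T} := FDist iid_pmf_ge0 iid_pmf_sum1.
End Iid.

Section Indep.
Variables (T U : finType) (d : fdist R T) (e : fdist R U).

Definition indep_pmf (tu : T * U) : R := d tu.1 * e tu.2.

Fact indep_pmf_ge0 tu : 0 <= indep_pmf tu.
Proof. by apply: mulr_ge0; exact: pmf_ge0. Qed.

Fact indep_pmf_sum1 : \sum_tu indep_pmf tu = 1.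
Proof.
rewrite -(pair_bigA _ (fun t u => d t * e u)) /=.
under eq_bigr do rewrite -mulr_sumr pmf_sum1 mulr1.
exact: pmf_sum1.
Qed.

Definition indep : fdist R (T * U)%type := FDist indep_pmf_ge0 indep_pmf_sum1.
End Indep.

End Products.

Section Queries.
Variables (R : realType) (V : finType) (D : V -> finType).

Definition assignment : finType := {dffun forall v : V, D v}.

(* [a v = None] means that [a] leaves [v] unassigned; the set of variables
   assigned by [a] is [dom a]. *)
Definition passignment : finType :=
  {dffun forall v : V, (option (D v) : finType)}.

Definition dom (a : passignment) : {set V} := [set v | isSome (a v)].

Definition matches (a : passignment) (z : assignment) : bool :=
  [forall v, if a v is Some c then z v == c else true].

Definition legal (p : fdist R assignment) (q : passignment * passignment) :=
  [disjoint dom q.1 & dom q.2] && (0 < Pr p (matches q.2)).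

Definition query (p : fdist R assignment) : finType :=
  {q : passignment * passignment | legal p q}.

Definition qx (p : fdist R assignment) (q : query p) : passignment :=
  (val q).1.
Definition qy (p : fdist R assignment) (q : query p) : passignment :=
  (val q).2.

(* [f] is a joint mass function; [dflt] is the value returned when the
   evidence [y] has mass zero. *)
Definition cond (f : assignment -> R) (x y : passignment) (dflt : R) : R :=
  if Pr f (matches y) == 0 then dflt
  else Pr f [pred z | matches x z && matches y z] / Pr f (matches y).

(* Legality of [q] makes the default value irrelevant. *)
Definition cond_true (p : fdist R assignment) (q : query p) : R :=
  cond p (qx q) (qy q) 0.

Definition parent_assignment (parent : rel V) (v : V) : finType :=
  {dffun forall u : {u : V | parent u v}, D (val u)}.

(* [parent u v] is the arc from [u] to [v]. *)
Record bayes_net := BayesNet {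
  bn_parent : rel V;
  bn_acyclic : forall c : seq V, cycle bn_parent c -> c = [::];
  bn_cpt : forall v : V, parent_assignment bn_parent v -> fdist R (D v) }.

Definition restrict_parents (parent : rel V) (v : V) (z : assignment) :
  parent_assignment parent v := [ffun u => z (val u)].

Definition bn_joint (B : bayes_net) (z : assignment) : R :=
  \prod_(v : V) bn_cpt (restrict_parents (bn_parent B) v z) (z v).

(* A net may give probability zero to evidence that has positive probability
   under [p]; the value it then returns is [b0 q]. *)
Definition bn_answer (p : fdist R assignment) (B : bayes_net)
    (b0 : query p -> R) (q : query p) : R :=
  cond (bn_joint B) (qx q) (qy q) (b0 q).

Definition err (p : fdist R assignment) (sq : fdist R (query p))
    (B : bayes_net) (b0 : query p -> R) : R :=
  \sum_(q : query p) sq q * (bn_answer B b0 q - cond_true q) ^+ 2.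

Definition nmatch (n : nat) (S : {ffun 'I_n -> assignment})
    (E : pred assignment) : nat := #|[set j : 'I_n | E (S j)]|.

(* [e0] supplies the arbitrary value used when no example matches the
   evidence; it may depend on both the sample and the query. *)
Definition empirical_cond (p : fdist R assignment) (n : nat)
    (e0 : {ffun 'I_n -> assignment} -> query p -> R)
    (S : {ffun 'I_n -> assignment}) (q : query p) : R :=
  if nmatch S (matches (qy q)) == 0%N then e0 S q
  else (nmatch S [pred z | matches (qx q) z && matches (qy q) z])%:R
       / (nmatch S (matches (qy q)))%:R.

Definition empirical_err (p : fdist R assignment) (B : bayes_net)
    (b0 : query p -> R) (m n : nat)
    (e0 : {ffun 'I_n -> assignment} -> query p -> R)
    (SSQ : {ffun 'I_m -> query p}) (SD : {ffun 'I_n -> assignment}) : R :=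
  m%:R^-1 *
  \sum_(i < m) (bn_answer B b0 (SSQ i) - empirical_cond e0 SD (SSQ i)) ^+ 2.

End Queries.

Section SampleSizes.
Variable R : realType.

(* The arguments of the ceilings below are positive whenever
   0 < epsilon, delta < 1, so taking the absolute value of the integer
   ceiling only changes its type. *)
Definition M_SQ (epsilon delta : R) : nat :=
  absz (Num.ceil (2 / epsilon ^+ 2 * ln (4 / delta))).

Definition M'_D (epsilon delta : R) : R :=
  8 / epsilon ^+ 2 * ln (2 * (M_SQ epsilon delta)%:R / delta).

Definition M_D (epsilon delta lambda : R) : nat :=
  let L := ln (4 * (M_SQ epsilon delta)%:R / delta) in
  absz (Num.ceil (Num.max (2 / lambda * (M'_D epsilon delta + L))
                          (8 / epsilon ^+ 2 * L))).
End SampleSizes.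

(* Main.v *)
(** Two deviations are controlled separately. By Hoeffding's inequality, the
average of the true squared losses over the query sample is within [epsilon/2]
of [err] except with probability [delta/2]. For a fixed query [(x; y)] and
[a = epsilon/4], the estimate is off by [a] or more only if
[\sum_j Y_j (X_j - p(x|y) - a) >= 0] (or the same with [X_j] complemented),
where [Y_j] and [X_j] tell whether example [j] matches [y] and [x]. Instead of
first bounding the number of matches from below, as the form of [M_D] suggests,
the exponential moment of this sum is bounded at once, by
[(1 - p(y) (1 - expR (- epsilon^2/8)))^M_D]. The splitting through the number
of matches loses too much for the stated [M'_D], whereas this bound leaves room
for a union bound over the [M_SQ] queries and both signs. *)
Require Import Defs.
From HB Require Import structures.
From mathcomp Require Import all_boot all_order all_algebra.
From mathcomp Require Import reals exp.
From mathcomp Require Import boolp classical_sets functions.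
From mathcomp Require Import topology normedtype derive realfun sequences.
From mathcomp Require Import lra ring.

Set Implicit Arguments.
Unset Strict Implicit.
Unset Printing Implicit Defensive.

Import Order.TTheory GRing.Theory Num.Theory.
Import numFieldNormedType.Exports.
Local Open Scope ring_scope.

(** * Calculus and Hoeffding's lemma *)

Lemma is_derive_ext (R : realType) (f g : R -> R) (x d e : R) :
  is_derive x (1 : R) f d -> f =1 g -> d = e -> is_derive x (1 : R) g e.
Proof. by move=> df /funext <- <-. Qed.

Lemma ge0_derive_ge0 (R : realType) (f f' : R -> R) (t : R) : 0 <= t ->
  (forall x : R, is_derive x (1 : R) f (f' x)) ->
  (forall x, 0 < x -> 0 <= f' x) -> f 0 = 0 -> 0 <= f t.
Proof.
rewrite le_eqVlt => /predU1P[<- _ _ ->//|t_gt0] df f'_ge0 f0.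
have [|x] := @MVT R f f' 0 t t_gt0 (fun x _ => df x).
  by apply: derivable_within_continuous => x _; apply: ex_derive.
rewrite in_itv /= f0 !subr0 => /andP[x_gt0 _] ->.
by rewrite mulr_ge0 ?f'_ge0 // ltW.
Qed.

Section Hoeffding.
Variable R : realType.
Implicit Types (m t x : R).

Lemma bernoulli_mgf_gt0 m t : 0 <= m <= 1 -> 0 < 1 - m + m * expR t.
Proof.
move=> /andP[m_ge0 m_le1]; have e_gt0 := expR_gt0 t.
have [->|m_neq0] := eqVneq m 0; first by rewrite mul0r addr0 subr0.
have m_gt0 : 0 < m by rewrite lt0r m_neq0.
have me_gt0 := mulr_gt0 m_gt0 e_gt0; lra.
Qed.

(** Let [g] be the exponent on the right minus the logarithm of the left side. Then [g] and [g']
    vanish at 0, and [g''] is [1/4 - s (1 - s) >= 0], where [s] is the success probability of the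
    exponentially tilted Bernoulli law. *)
Lemma bernoulli_mgf_le m t : 0 <= m <= 1 -> 0 <= t ->
  1 - m + m * expR t <= expR (t * m + t ^+ 2 / 8).
Proof.
move=> m01 t_ge0.
pose w x := 1 - m + m * expR x.
have w_gt0 x : 0 < w x by exact: bernoulli_mgf_gt0.
have dw x : is_derive x (1 : R) w (m * expR x).
  have h := is_deriveD (is_derive_cst (1 - m) x (1 : R))
                       (is_deriveZ m (is_derive_expR x)).
  by apply: is_derive_ext h _ _ => //; rewrite add0r.
have dlnw x : is_derive x (1 : R) (fun x => ln (w x)) ((w x)^-1 * (m * expR x)).
  exact: is_derive1_comp (is_derive1_ln (w_gt0 x)) (dw x).
rewrite -[X in X <= _]lnK ?posrE ?w_gt0// ler_expR -subr_ge0.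
pose g x := (x * m + x ^+ 2 / 8) - ln (w x).
pose g' x := (m + x / 4) - (w x)^-1 * (m * expR x).
pose g'' x := 4^-1 - (w x)^-1 * (m * expR x) * (1 - (w x)^-1 * (m * expR x)).
have did x := is_derive_id x (1 : R).
have dg x : is_derive x (1 : R) g (g' x).
  have h := is_deriveB (is_deriveD (is_deriveZ m (did x))
    (is_deriveZ 8^-1 (is_deriveX 2 (did x)))) (dlnw x).
  apply: is_derive_ext h _ _ => [y|].
    by rewrite -[LHS]/(m * y + 8^-1 * y ^+ 2 - ln (w y)) /g; ring.
  rewrite -[LHS]/(m * 1 + 8^-1 * (2 * x ^+ 1 * 1) - (w x)^-1 * (m * expR x)) /g'.
  by field; exact: lt0r_neq0.
have dg' x : is_derive x (1 : R) g' (g'' x).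
  have h := is_deriveB (is_deriveD (is_derive_cst m x (1 : R))
    (is_deriveZ 4^-1 (did x)))
    (is_deriveM (is_deriveV (lt0r_neq0 (w_gt0 x)) (dw x))
                (is_deriveZ m (is_derive_expR x))).
  apply: is_derive_ext h _ _ => [y|].
    by rewrite -[LHS]/(m + 4^-1 * y - (w y)^-1 * (m * expR y)) /g'; ring.
  rewrite -[LHS]/(0 + 4^-1 * 1 - ((w x)^-1 * (m * expR x)
    + m * expR x * (- (w x) ^- 2 * (m * expR x)))) /g''.
  by field; exact: lt0r_neq0.
apply: (@ge0_derive_ge0 R g g') => // [x x_gt0|]; last first.
  by rewrite /g /w expR0 mulr1 subrK ln1; lra.
apply: (@ge0_derive_ge0 R g' g'') => // [|y _|]; first exact: ltW.
  by rewrite /g''; move: (_^-1 * _) => s; have := sqr_ge0 (s - 2^-1); nra.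
by rewrite /g' /w expR0 mulr1 subrK; lra.
Qed.

(** Convexity: the tangent at [t * z] lies below the exponential at 0 and at [t], and averaging
    these two values of the tangent with weights [1 - z] and [z] gives [expR (t * z)]. *)
Lemma expR_chord t z : 0 <= z <= 1 -> expR (t * z) <= 1 - z + z * expR t.
Proof.
move=> /andP[z_ge0 z_le1].
have tangent y : expR (t * z) * (1 + (y - t * z)) <= expR y.
  rewrite -[X in _ <= X](_ : expR (t * z) * expR (y - t * z) = _).
    by rewrite ler_wpM2l ?expR_ge0 ?expR_ge1Dx.
  by rewrite -expRD addrC subrK.
have z'_ge0 : 0 <= 1 - z by rewrite subr_ge0.
have := lerD (ler_wpM2l z'_ge0 (tangent 0)) (ler_wpM2l z_ge0 (tangent t)).
by rewrite expR0; lra.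
Qed.

(** The weights are not normalized, so that the bound applies to a distribution restricted to an
    event without dividing by its probability. The chord bound reduces [Z] to a Bernoulli variable
    of mean [m]. *)
Lemma hoeffding_mgf (T : finType) (w Z : T -> R) (m t : R) :
    (forall i, 0 <= w i) -> (forall i, 0 <= Z i <= 1) ->
    0 <= m <= 1 -> 0 <= t -> \sum_i w i * Z i = m * \sum_i w i ->
  \sum_i w i * expR (t * (Z i - m)) <= (\sum_i w i) * expR (t ^+ 2 / 8).
Proof.
move=> w_ge0 Z01 m01 t_ge0 wZ.
have -> : \sum_i w i * expR (t * (Z i - m)) =
          expR (- (t * m)) * \sum_i w i * expR (t * Z i).
  by rewrite mulr_sumr; apply: eq_bigr => i _; rewrite mulrBr expRD; ring.
have -> : expR (t ^+ 2 / 8) = expR (- (t * m)) * expR (t * m + t ^+ 2 / 8).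
  by rewrite -expRD addKr.
rewrite mulrCA ler_wpM2l ?expR_ge0 //.
have W_ge0 : 0 <= \sum_i w i by exact: sumr_ge0.
apply: le_trans (ler_wpM2l W_ge0 (bernoulli_mgf_le m01 t_ge0)).
rewrite [X in _ <= X](_ : _ = \sum_i w i * (1 - Z i + Z i * expR t)).
  by apply: ler_sum => i _; rewrite ler_wpM2l ?expR_chord.
under [RHS]eq_bigr do rewrite mulrDr mulrBr mulr1 mulrA.
by rewrite big_split sumrB -mulr_suml /= wZ; ring.
Qed.

(** The choice [t = 4 * a] minimizes [t ^+ 2 / 8 - t * a]. *)
Lemma hoeffding_mgf_shift (T : finType) (w Z : T -> R) (m a : R) :
    (forall i, 0 <= w i) -> (forall i, 0 <= Z i <= 1) ->
    0 <= m <= 1 -> 0 <= a -> \sum_i w i * Z i = m * \sum_i w i ->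
  \sum_i w i * expR (4 * a * (Z i - m - a)) <=
    (\sum_i w i) * expR (- (2 * a ^+ 2)).
Proof.
move=> w_ge0 Z01 m01 a_ge0 wZ.
have a4_ge0 : 0 <= 4 * a by rewrite mulr_ge0.
have := hoeffding_mgf w_ge0 Z01 m01 a4_ge0 wZ.
move=> /(ler_wpM2r (expR_ge0 (- (4 * a * a)))).
rewrite -[X in _ <= X -> _]mulrA -expRD.
rewrite (_ : (4 * a) ^+ 2 / 8 - 4 * a * a = - (2 * a ^+ 2)); last by field.
move=> h; apply: le_trans h; rewrite mulr_suml ler_sum // => i _.
by rewrite mulrBr expRD mulrA.
Qed.

End Hoeffding.

(** * Elementary facts on finite probability *)

Section Probability.
Variables (R : realType) (T : finType).
Implicit Types (d : fdist R T) (E F : pred T).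

Lemma Pr_ge0 d E : 0 <= Pr d E.
Proof. by apply: sumr_ge0 => t _; exact: pmf_ge0. Qed.

Lemma Pr_le1 d E : Pr d E <= 1.
Proof.
rewrite -(pmf_sum1 d) /Pr [X in _ <= X](bigID E) /= lerDl.
by apply: sumr_ge0 => t _; exact: pmf_ge0.
Qed.

Lemma PrE d E : Pr d E = \sum_t d t * (E t)%:R.
Proof.
rewrite /Pr big_mkcond; apply: eq_bigr => t _.
by case: (E t); rewrite ?mulr1 ?mulr0.
Qed.

Lemma Pr_not d E : Pr d [pred t | ~~ E t] = 1 - Pr d E.
Proof.
by rewrite -(pmf_sum1 d) [in RHS](bigID E) /= /Pr addrAC subrr add0r.
Qed.

Lemma Pr_sub d E F : (forall t, 0 < d t -> E t -> F t) -> Pr d E <= Pr d F.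
Proof.
move=> EF; rewrite !PrE; apply: ler_sum => t _.
have := pmf_ge0 d t; rewrite le_eqVlt => /predU1P[<-|d_gt0].
  by rewrite !mul0r.
rewrite ler_wpM2l ?pmf_ge0 // ler_nat.
by case: (boolP (E t)) => // /(EF _ d_gt0) ->.
Qed.

Lemma Pr_or d E F : Pr d [pred t | E t || F t] <= Pr d E + Pr d F.
Proof.
rewrite !PrE -big_split /=; apply: ler_sum => t _.
rewrite -mulrDr ler_wpM2l ?pmf_ge0 // -natrD ler_nat /=.
by case: (E t); case: (F t).
Qed.

Lemma Pr_exists (I : finType) d (E : I -> pred T) :
  Pr d [pred t | [exists i, E i t]] <= \sum_i Pr d (E i).
Proof.
under eq_bigr do rewrite PrE.
rewrite PrE exchange_big /=; apply: ler_sum => t _.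
rewrite -mulr_sumr ler_wpM2l ?pmf_ge0 // -natr_sum ler_nat.
by rewrite /=; case: existsP => // -[i Ei]; rewrite (bigD1 i) //= Ei.
Qed.

End Probability.

(** * Tail bounds for independent draws *)

Section Iid.
Variables (R : realType) (T : finType).
Implicit Type d : fdist R T.

(** The indicator of a nonnegative sum is at most [expR] of the sum, whose expectation factors over
    the draws. *)
Lemma iid_chernoff n d (f : T -> R) :
  Pr (iid n d) [pred s : {ffun 'I_n -> T} | 0 <= \sum_j f (s j)] <=
    (\sum_t d t * expR (f t)) ^+ n.
Proof.
have -> : (\sum_t d t * expR (f t)) ^+ n =
    \sum_(s : {ffun 'I_n -> T}) iid n d s * expR (\sum_j f (s j)).
  rewrite -[in LHS](card_ord n) -prodr_const.
  rewrite (bigA_distr_bigA (fun _ t => d t * expR (f t))) /=.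
  by apply: eq_bigr => s _; rewrite big_split /= expR_sum.
rewrite PrE; apply: ler_sum => s _; rewrite ler_wpM2l ?pmf_ge0 //=.
have [f_ge0|_] := leP 0 (\sum_(j < n) f (s j)); last exact: expR_ge0.
by rewrite -[leLHS]expR0 ler_expR.
Qed.

(** The last hypothesis says, without division, that [m] is the mean of [Z] given [Y]. A draw
    outside [Y] contributes a factor 1 to the exponential moment, a draw in [Y] on average at most
    [expR (- (2 * a ^+ 2))]. *)
Lemma iid_hoeffding_upper n d (Y : pred T) (Z : T -> R) (m a : R) :
    (forall t, 0 <= Z t <= 1) -> 0 <= m <= 1 -> 0 < a ->
    \sum_t d t * (Y t)%:R * Z t = m * Pr d Y ->
  Pr (iid n d) [pred s : {ffun 'I_n -> T} |
      0 <= \sum_j (Y (s j))%:R * (Z (s j) - m - a)] <=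
    (1 - Pr d Y * (1 - expR (- (2 * a ^+ 2)))) ^+ n.
Proof.
move=> Z01 m01 a_gt0 dZ.
have -> : Pr (iid n d)
    [pred s : {ffun 'I_n -> T} | 0 <= \sum_j (Y (s j))%:R * (Z (s j) - m - a)] =
  Pr (iid n d)
    [pred s : {ffun 'I_n -> T} | 0 <= \sum_j (Y (s j))%:R * (4 * a * (Z (s j) - m - a))].
  apply: eq_bigl => s /=; under [in RHS]eq_bigr do rewrite mulrCA.
  by rewrite -mulr_sumr pmulr_rge0 // mulr_gt0.
apply: le_trans (iid_chernoff _ _ (fun t => (Y t)%:R * (4 * a * (Z t - m - a)))) _.
rewrite lerXn2r ?nnegrE //.
- by apply: sumr_ge0 => t _; rewrite mulr_ge0 ?pmf_ge0 ?expR_ge0.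
- rewrite subr_ge0 mulr_ile1 ?Pr_ge0 ?Pr_le1 //.
    by rewrite subr_ge0 -[leRHS]expR0 ler_expR oppr_le0 mulr_ge0 ?sqr_ge0.
  by rewrite gerBl expR_ge0.
have w_ge0 t : 0 <= d t * (Y t)%:R by rewrite mulr_ge0 ?pmf_ge0.
have wZ : \sum_t d t * (Y t)%:R * Z t = m * \sum_t d t * (Y t)%:R.
  by rewrite -PrE.
have := hoeffding_mgf_shift w_ge0 Z01 m01 (ltW a_gt0) wZ.
rewrite -PrE => h.
have -> : 1 - Pr d Y * (1 - expR (- (2 * a ^+ 2))) =
   Pr d [pred t | ~~ Y t] + Pr d Y * expR (- (2 * a ^+ 2)) by rewrite Pr_not; ring.
apply: le_trans (lerD (lexx _) h).
rewrite PrE -big_split /=; apply: ler_sum => t _.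
by case: (Y t); rewrite /= ?(mul1r, mul0r, mulr1, mulr0, add0r, addr0, expR0).
Qed.

(** The lower tail is the upper tail of [1 - Z]. A sample without draws in [Y] lies in this event,
    both sides being 0. *)
Lemma iid_hoeffding n d (Y : pred T) (Z : T -> R) (m a : R) :
    (forall t, 0 <= Z t <= 1) -> 0 <= m <= 1 -> 0 < a ->
    \sum_t d t * (Y t)%:R * Z t = m * Pr d Y ->
  Pr (iid n d) [pred s : {ffun 'I_n -> T} | a * \sum_j (Y (s j))%:R <=
                         `|\sum_j (Y (s j))%:R * (Z (s j) - m)|] <=
    2 * (1 - Pr d Y * (1 - expR (- (2 * a ^+ 2)))) ^+ n.
Proof.
move=> Z01 m01 a_gt0 dZ.
have Z'01 t : 0 <= 1 - Z t <= 1 by have /andP[? ?] := Z01 t; apply/andP; split; lra.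
have m'01 : 0 <= 1 - m <= 1 by have /andP[? ?] := m01; apply/andP; split; lra.
have dZ' : \sum_t d t * (Y t)%:R * (1 - Z t) = (1 - m) * Pr d Y.
  under eq_bigr do rewrite mulrBr mulr1.
  by rewrite sumrB dZ -PrE mulrBl mul1r.
rewrite mulr2n mulrDl mul1r.
apply: le_trans (lerD (iid_hoeffding_upper n Z01 m01 a_gt0 dZ)
                      (iid_hoeffding_upper n Z'01 m'01 a_gt0 dZ')).
apply: le_trans (Pr_or _ _ _); apply: Pr_sub => s _ /=.
have E (f : T -> R) : \sum_j (Y (s j))%:R * (f (s j) - a) =
    \sum_j (Y (s j))%:R * f (s j) - a * \sum_j (Y (s j))%:R.
  by rewrite mulr_sumr -sumrB; apply: eq_bigr => j _; ring.
rewrite (E (fun t => Z t - m)) (E (fun t => 1 - Z t - (1 - m))) !subr_ge0.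
have -> : \sum_j (Y (s j))%:R * (1 - Z (s j) - (1 - m)) =
          - \sum_j (Y (s j))%:R * (Z (s j) - m).
  by rewrite -sumrN; apply: eq_bigr => j _; ring.
by rewrite ler_normr.
Qed.

End Iid.

(** * Arithmetic of the sample sizes *)

Section SampleSizeBounds.
Variable R : realType.
Implicit Types (eps del lam q x : R).

Lemma ge_absz_ceil x : x <= (absz (Num.ceil x))%:R.
Proof. by rewrite natr_absz (le_trans (ceil_ge x)) ?ler_int ?ler_norm. Qed.

Lemma ln4_gt_half : 2^-1 < ln (4 : R).
Proof.
have h : ln (1 + (- 3 / 4) : R) <= - 3 / 4 by apply: le_ln1Dx; lra.
have e : ln (1 + (- 3 / 4) : R) = - ln 4.
  by rewrite -lnV ?posrE //; congr ln; field.
by rewrite e in h; lra.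
Qed.

(** Two queries at least make [2 * M_SQ / delta] at least 4, as [estimate_deviation_bound] requires
    of its [q]. *)
Lemma M_SQ_gt1 eps del : 0 < eps < 1 -> 0 < del < 1 -> (1 < M_SQ eps del)%N.
Proof.
move=> /andP[eps_gt0 eps_lt1] /andP[del_gt0 del_lt1].
rewrite -(ltr_nat R); apply: lt_le_trans (ge_absz_ceil _).
have h4 : ln 4 <= ln (4 / del).
  rewrite ler_ln ?posrE ?divr_gt0 //.
  by rewrite ler_pdivlMr // ger_pMr // ltW.
have e2 : 2 <= 2 / eps ^+ 2.
  by rewrite ler_pdivlMr ?exprn_gt0 // ger_pMr // exprn_ile1 ?ltW.
have := ln4_gt_half; nra.
Qed.

(** The exponent [M_SQ * eps ^+ 2 / 2] is at least [ln (4 / del)], so each of the two tails has mass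
    at most [del / 4]. *)
Lemma query_deviation_bound eps del : 0 < eps < 1 -> 0 < del < 1 ->
  2 * expR (- (2 * (eps / 2) ^+ 2)) ^+ M_SQ eps del <= del / 2.
Proof.
move=> /andP[eps_gt0 eps_lt1] /andP[del_gt0 del_lt1].
rewrite -expRM_natl.
have := ge_absz_ceil (2 / eps ^+ 2 * ln (4 / del)).
rewrite -/(M_SQ eps del); move: (M_SQ eps del) => m hm.
have e2_gt0 : 0 < eps ^+ 2 / 2 by rewrite divr_gt0 ?exprn_gt0.
have {}hm : ln (4 / del) <= m%:R * (2 * (eps / 2) ^+ 2).
  move: hm => /(ler_wpM2r (ltW e2_gt0)).
  rewrite (_ : 2 / eps ^+ 2 * _ * _ = ln (4 / del)); last by field; exact: lt0r_neq0.
  by rewrite (_ : m%:R * (eps ^+ 2 / 2) = m%:R * (2 * (eps / 2) ^+ 2)) //; field.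
have : expR (- (m%:R * (2 * (eps / 2) ^+ 2))) <= expR (- ln (4 / del)).
  by rewrite ler_expR lerN2.
by rewrite [leRHS]expRN lnK ?posrE ?divr_gt0 // invf_div mulrN; lra.
Qed.

(* The exponent obtained is [16/9 * ln q], and since [q >= 4] its excess over
   [ln q] absorbs the factor 2 in front. *)
Lemma estimate_deviation_bound eps lam pi q n :
  0 < eps < 1 -> 0 < lam <= pi -> pi <= 1 -> 4 <= q ->
  2 / lam * (8 / eps ^+ 2 * ln q) <= n%:R ->
  2 * (1 - pi * (1 - expR (- (2 * (eps / 4) ^+ 2)))) ^+ n <= q^-1.
Proof.
move=> /andP[eps_gt0 eps_lt1] /andP[lam_gt0 lam_pi] pi_le1 q_ge4 n_ge.
have q_gt0 : 0 < q by lra.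
set u := 2 * (eps / 4) ^+ 2; set c := 1 - expR (- u).
have u_gt0 : 0 < u by rewrite mulr_gt0 ?exprn_gt0 ?divr_gt0.
have u_le : u <= 8^-1.
  have : eps ^+ 2 <= 1 by rewrite exprn_ile1 ?ltW.
  by rewrite /u expr_div_n => ?; lra.
have c_ge : 8 / 9 * u <= c.
  have : expR (- u) * (1 + u) <= 1.
    rewrite expRN ler_pdivrMl ?expR_gt0 // mulr1; exact: expR_ge1Dx.
  have := expR_gt0 (- u); rewrite /c; nra.
have u89_gt0 : 0 < 8 / 9 * u by lra.
have c_le1 : c <= 1 by rewrite gerBl expR_ge0.
have c_ge0 : 0 <= c by apply: le_trans c_ge; exact: ltW.
have pi_ge0 : 0 <= pi by apply: le_trans lam_pi; exact: ltW.
have pow_le : (1 - pi * c) ^+ n <= expR (- (n%:R * (pi * c))).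
  rewrite -[in leRHS]mulrN expRM_natl lerXn2r ?nnegrE ?expR_ge0 //; last exact: expR_ge1Dx.
  by rewrite subr_ge0 mulr_ile1.
have lnq : 2 * ln 2 <= ln q.
  rewrite -[leLHS](_ : ln 4 = _); first by rewrite ler_ln ?posrE.
  by rewrite (_ : 4 = 2 ^+ 2 :> R) ?lnXn //; ring.
have exponent : ln 2 + ln q <= n%:R * (pi * c).
  (* Since [u = eps ^+ 2 / 8], the factors [lam] and [eps ^+ 2] cancel, leaving
     [2 * 8 * (8 / 9) / 8]. *)
  have h1 : 16 / 9 * ln q <= n%:R * (lam * (8 / 9 * u)).
    have k_ge0 : 0 <= lam * (8 / 9 * u) by exact/ltW/mulr_gt0.
    apply: le_trans (ler_wpM2r k_ge0 n_ge); rewrite le_eqVlt; apply/orP; left.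
    by apply/eqP; rewrite /u; field; rewrite !lt0r_neq0.
  have h2 : n%:R * (lam * (8 / 9 * u)) <= n%:R * (pi * c).
    by rewrite ler_wpM2l // ler_pM // ltW.
  have ln2_ge0 : 0 <= ln (2 : R) by rewrite ln_ge0 //; lra.
  lra.
have : expR (- (n%:R * (pi * c))) <= (2 * q)^-1.
  by rewrite -[leRHS]lnK ?posrE ?invr_gt0 ?mulr_gt0 // ler_expR
             lnV ?posrE ?mulr_gt0 // lnM ?posrE // lerN2.
by rewrite invfM; lra.
Qed.

End SampleSizeBounds.

(** * Range and accuracy of the answers and estimates *)

Section Score.
Variables (R : realType) (V : finType) (D : V -> finType).
Implicit Type p : fdist R (assignment D).

Lemma cond_01 (f : assignment D -> R) (x y : passignment D) (dflt : R) :
  (forall z, 0 <= f z) -> 0 <= dflt <= 1 -> 0 <= cond f x y dflt <= 1.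
Proof.
move=> f_ge0 dflt01; rewrite /cond; case: ifPn => // y_neq0.
have y_ge0 : 0 <= Pr f (matches y) by apply: sumr_ge0 => z _.
have y_gt0 : 0 < Pr f (matches y) by rewrite lt0r y_neq0.
rewrite divr_ge0 //=; last by apply: sumr_ge0 => z _.
rewrite ler_pdivrMr // mul1r /Pr [leRHS](bigID (matches x)) /=.
rewrite (eq_bigl (fun z => matches y z && matches x z)) ?lerDl ?sumr_ge0 //.
by move=> z /=; rewrite andbC.
Qed.

Lemma bn_answer_01 p (B : bayes_net R D) (b0 : query p -> R) q :
  (forall q, 0 <= b0 q <= 1) -> 0 <= bn_answer B b0 q <= 1.
Proof.
by move=> b0_01; apply: cond_01 => // z; apply: prodr_ge0 => v _; exact: pmf_ge0.
Qed.

Lemma cond_true_01 p (q : query p) : 0 <= cond_true q <= 1.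
Proof. by apply: cond_01; [exact: pmf_ge0 | rewrite lexx ler01]. Qed.

Lemma nmatchE n (S : {ffun 'I_n -> assignment D}) (E : pred (assignment D)) :
  (nmatch S E)%:R = \sum_j (E (S j))%:R :> R.
Proof.
rewrite /nmatch cardsE -sum1_card natr_sum big_mkcond /=.
by apply: eq_bigr => j _; rewrite unfold_in; case: (E (S j)).
Qed.

Lemma empirical_cond_01 p n (e0 : {ffun 'I_n -> assignment D} -> query p -> R) S q :
  (forall S q, 0 <= e0 S q <= 1) -> 0 <= empirical_cond e0 S q <= 1.
Proof.
move=> e0_01; rewrite /empirical_cond; case: ifPn => // K_neq0.
rewrite divr_ge0 //= ler_pdivrMr ?ltr0n ?lt0n // mul1r ler_nat.
by apply/subset_leq_card/fintype.subsetP => j; rewrite !inE => /andP[].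
Qed.

(** Multiplied by the number of matching examples, the deviation becomes the division-free event of
    [iid_hoeffding], with [Y] for matching the evidence and [Z] for matching [qx q]. *)
Lemma empirical_cond_deviation p n
    (e0 : {ffun 'I_n -> assignment D} -> query p -> R) (q : query p) (a : R) :
  0 < a ->
  Pr (iid n p) [pred S : {ffun 'I_n -> assignment D} |
      a <= `|empirical_cond e0 S q - cond_true q|] <=
    2 * (1 - Pr p (matches (qy q)) * (1 - expR (- (2 * a ^+ 2)))) ^+ n.
Proof.
move=> a_gt0.
pose Z z : R := (matches (qx q) z)%:R.
have Z01 z : 0 <= Z z <= 1 by rewrite /Z ler0n lern1 leq_b1.
have y_gt0 : 0 < Pr p (matches (qy q)) by case/andP: (valP q).
have pZ : \sum_z p z * (matches (qy q) z)%:R * Z z =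
          cond_true q * Pr p (matches (qy q)).
  rewrite /cond_true /cond gt_eqF // divfK ?gt_eqF // PrE.
  by apply: eq_bigr => z _; rewrite -mulrA -natrM mulnb andbC.
apply: le_trans (iid_hoeffding n Z01 (cond_true_01 q) a_gt0 pZ).
apply: Pr_sub => S _ /=; rewrite -nmatchE /empirical_cond.
(* With no matching example the threshold is [a * 0], so the larger event holds whatever value [e0]
   supplies. *)
case: ifPn => [/eqP-> _|K_neq0]; first by rewrite mulr0.
have K_gt0 : 0 < (nmatch S (matches (qy q)))%:R :> R by rewrite ltr0n lt0n.
have -> : \sum_j (matches (qy q) (S j))%:R * (Z (S j) - cond_true q) =
    (nmatch S [pred z | matches (qx q) z && matches (qy q) z])%:R
    - cond_true q * (nmatch S (matches (qy q)))%:R.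
  rewrite !nmatchE mulr_sumr -sumrB; apply: eq_bigr => j _ /=.
  by rewrite mulrBr -natrM mulnb andbC [cond_true q * _]mulrC.
move=> /(ler_wpM2r (ltW K_gt0)) /le_trans; apply.
by rewrite -{2}(gtr0_norm K_gt0) -normrM mulrBl divfK ?gt_eqF.
Qed.

End Score.

(** In the factored difference of squares, [(b - x) + (b - y)] is at most 2 in absolute value. Hence
    the tolerance [epsilon / 4] on each estimate. *)
Lemma sqr_diff_le (R : realType) (b x y c : R) :
  0 <= b <= 1 -> 0 <= x <= 1 -> 0 <= y <= 1 -> `|x - y| < c ->
  `|(b - x) ^+ 2 - (b - y) ^+ 2| <= 2 * c.
Proof.
move=> /andP[b_ge0 b_le1] /andP[x_ge0 x_le1] /andP[y_ge0 y_le1] /ltW xy.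
rewrite subr_sqr (_ : b - x - (b - y) = - (x - y)); last by ring.
rewrite normrM normrN mulrC; apply: ler_pM => //.
by rewrite ler_norml; apply/andP; split; lra.
Qed.

(** * Independent samples and the final estimate *)

Section IndependentSamples.
Variables (R : realType) (T U : finType) (d : fdist R T) (e : fdist R U).

Lemma Pr_indep (F : pred (T * U)) :
  Pr (indep d e) F = \sum_t d t * Pr e [pred u | F (t, u)].
Proof.
under [RHS]eq_bigr do rewrite PrE mulr_sumr.
by rewrite PrE pair_bigA; apply: eq_bigr => -[t u] _ /=; rewrite mulrA.
Qed.

Lemma Pr_indep_fst (E : pred T) : Pr (indep d e) [pred s | E s.1] = Pr d E.
Proof.
rewrite Pr_indep PrE; apply: eq_bigr => t _; congr (_ * _).
by rewrite PrE /= -mulr_suml pmf_sum1 mul1r.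
Qed.

(** Conditioning on the first component. Restricting to [t] of positive mass lets [sq_lambda] be
    used, through [iid_gt0], for each sampled query. *)
Lemma Pr_indep_le (F : pred (T * U)) c :
  (forall t, 0 < d t -> Pr e [pred u | F (t, u)] <= c) ->
  Pr (indep d e) F <= c.
Proof.
move=> Fc; rewrite Pr_indep -[leRHS]mul1r -(pmf_sum1 d) mulr_suml.
apply: ler_sum => t _; have := pmf_ge0 d t; rewrite le_eqVlt.
by case/predU1P => [<-|d_gt0]; rewrite ?mul0r // ler_wpM2l ?Fc // ltW.
Qed.

Lemma iid_gt0 n (s : {ffun 'I_n -> T}) i : 0 < iid n d s -> 0 < d (s i).
Proof.
rewrite /= /iid_pmf (bigD1 i) //=.
by have := pmf_ge0 d (s i); rewrite le_eqVlt => /predU1P[<-|//]; rewrite mul0r ltxx.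
Qed.

End IndependentSamples.

(** The squared losses lie in [[0, 1]] with mean [err]. With the sure event as [Y], the base in
    [iid_hoeffding] is [expR (- (2 * a ^+ 2))]. *)
Lemma query_sample_deviation (R : realType) (V : finType) (D : V -> finType)
    (p : fdist R (assignment D)) (sq : fdist R (query p)) (B : bayes_net R D)
    (b0 : query p -> R) (m : nat) (a : R) :
  (forall q, 0 <= b0 q <= 1) -> 0 < a -> (0 < m)%N ->
  Pr (iid m sq) [pred S : {ffun 'I_m -> query p} |
      a <= `|m%:R^-1 * \sum_(i < m) (bn_answer B b0 (S i) - cond_true (S i)) ^+ 2
             - err sq B b0|] <=
    2 * expR (- (2 * a ^+ 2)) ^+ m.
Proof.
move=> b0_01 a_gt0 m_gt0.
pose Z q := (bn_answer B b0 q - cond_true q) ^+ 2.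
have Z01 q : 0 <= Z q <= 1.
  have /andP[b_ge0 b_le1] := bn_answer_01 B q b0_01.
  have /andP[c_ge0 c_le1] := cond_true_01 q.
  rewrite /Z sqr_ge0 -real_normK ?num_real // exprn_ile1 // ler_norml.
  by apply/andP; split; lra.
have PT : Pr sq predT = 1 by rewrite /Pr pmf_sum1.
have err01 : 0 <= err sq B b0 <= 1.
  apply/andP; split.
    by apply: sumr_ge0 => q _; rewrite mulr_ge0 ?pmf_ge0 ?sqr_ge0.
  rewrite -(pmf_sum1 sq); apply: ler_sum => q _.
  by have /andP[_ Z_le1] := Z01 q; rewrite -[leRHS]mulr1 ler_wpM2l ?pmf_ge0.
have sqZ : \sum_q sq q * (predT q)%:R * Z q = err sq B b0 * Pr sq predT.
  by rewrite PT mulr1; apply: eq_bigr => q _; rewrite mulr1.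
have := iid_hoeffding m Z01 err01 a_gt0 sqZ.
rewrite PT mul1r subKr => h; apply: le_trans h; apply: Pr_sub => S _ /=.
have m_gt0R : 0 < m%:R :> R by rewrite ltr0n.
rewrite sumr_const card_ord => /(ler_wpM2r (ltW m_gt0R)) /le_trans; apply.
rewrite -{2}(gtr0_norm m_gt0R) -normrM mulrBl mulrAC mulVf ?gt_eqF // mul1r.
under [X in _ <= `|X|]eq_bigr do rewrite mul1r.
by rewrite sumrB sumr_const card_ord mulr_natr.
Qed.

Theorem corollary5 (R : realType) (V : finType) (D : V -> finType)
    (p : fdist R (assignment D)) (sq : fdist R (query p))
    (B : bayes_net R D)
    (b0 : query p -> R)
    (b0_01 : forall q, 0 <= b0 q <= 1)
    (epsilon delta lambda : R)
    (epsilon_01 : 0 < epsilon < 1)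
    (delta_01 : 0 < delta < 1)
    (lambda_gt0 : 0 < lambda)
    (sq_lambda : forall q : query p,
       0 < sq q -> lambda <= Pr p (matches (qy q)))
    (e0 : {ffun 'I_(M_D epsilon delta lambda) -> assignment D} -> query p -> R)
    (e0_01 : forall SD q, 0 <= e0 SD q <= 1) :
  1 - delta <=
  Pr (indep (iid (M_SQ epsilon delta) sq) (iid (M_D epsilon delta lambda) p))
     [pred S | `|empirical_err B b0 e0 S.1 S.2 - err sq B b0| < epsilon].

Proof.
have /andP[eps_gt0 eps_lt1] := epsilon_01; have /andP[del_gt0 del_lt1] := delta_01.
have m_gt1 := M_SQ_gt1 epsilon_01 delta_01.
have bad1 := query_deviation_bound epsilon_01 delta_01.
have q_ge4 : 4 <= 2 * (M_SQ epsilon delta)%:R / delta.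
  have : 2 <= (M_SQ epsilon delta)%:R :> R by rewrite ler_nat.
  by rewrite ler_pdivlMr //; nra.
have n_ge : 2 / lambda * (8 / epsilon ^+ 2 *
    ln (2 * (M_SQ epsilon delta)%:R / delta)) <= (M_D epsilon delta lambda)%:R.
  apply: le_trans (ge_absz_ceil _); rewrite le_max; apply/orP; left.
  rewrite ler_wpM2l ?divr_ge0 ?(ltW lambda_gt0) // lerDl ln_ge0 //.
  have -> : 4 * (M_SQ epsilon delta)%:R / delta =
            2 * (2 * (M_SQ epsilon delta)%:R / delta) by field; exact: lt0r_neq0.
  lra.
(* From here the sizes are arbitrary numbers subject to these bounds; [e0] is generalized too, since
   its type depends on the second size. *)
move: (M_SQ epsilon delta) (M_D epsilon delta lambda) m_gt1 bad1 q_ge4 n_ge e0 e0_01.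
move=> m n m_gt1 bad1 q_ge4 n_ge {}e0 {}e0_01.
have m_gt0 : (0 < m)%N by exact: ltnW.
have mR_gt0 : 0 < m%:R :> R by rewrite ltr0n.
have eps4_gt0 : 0 < epsilon / 4 by rewrite divr_gt0.
pose Z q := (bn_answer B b0 q - cond_true q) ^+ 2.
pose far1 (s : {ffun 'I_m -> query p}) :=
  epsilon / 2 <= `|m%:R^-1 * \sum_(i < m) Z (s i) - err sq B b0|.
pose far2 (S : {ffun 'I_n -> assignment D}) q :=
  epsilon / 4 <= `|empirical_cond e0 S q - cond_true q|.
pose samples := ({ffun 'I_m -> query p} * {ffun 'I_n -> assignment D})%type.
have P1 : Pr (indep (iid m sq) (iid n p)) [pred S : samples | far1 S.1] <= delta / 2.
  rewrite (Pr_indep_fst _ _ far1); apply: le_trans bad1.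
  by apply: query_sample_deviation => //; rewrite divr_gt0.
have P2 : Pr (indep (iid m sq) (iid n p))
    [pred S : samples | [exists i, far2 S.2 (S.1 i)]] <= delta / 2.
  (* With the query sample fixed, a union bound runs over its [m] queries, each failing with
     probability at most [delta / (2 * m)]. *)
  apply: Pr_indep_le => s s_gt0.
  apply: le_trans (Pr_exists (iid n p) (fun i S => far2 S (s i))) _.
  apply: (@le_trans _ _ (\sum_(i < m) (2 * m%:R / delta)^-1)).
    apply: ler_sum => i _.
    apply: le_trans; first exact: (empirical_cond_deviation e0 (s i) eps4_gt0).
    apply: estimate_deviation_bound n_ge => //; last exact: Pr_le1.
    by rewrite lambda_gt0 sq_lambda ?(iid_gt0 i s_gt0).
  rewrite sumr_const card_ord -mulr_natr le_eqVlt; apply/orP; left.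
  by apply/eqP; field; rewrite !lt0r_neq0.
rewrite -[leRHS](subKr 1) -Pr_not lerB // [leRHS]splitr.
apply: le_trans (lerD P1 P2); apply: le_trans (Pr_or _ _ _).
apply: Pr_sub => -[s S] _ /=; apply: contraNT.
rewrite negb_or negb_exists -ltNge => /andP[near1 /forallP near2].
(* Each squared loss moves by at most [2 * (epsilon / 4)], hence so does the average. The final
   strict inequality comes from [near1]. *)
have {}near2 : `|empirical_err B b0 e0 s S - m%:R^-1 * \sum_(i < m) Z (s i)|
                 <= epsilon / 2.
  rewrite /empirical_err -mulrBr -sumrB normrM gtr0_norm ?invr_gt0 //.
  rewrite ler_pdivrMl //; apply: le_trans (ler_norm_sum _ _ _) _.
  rewrite mulrC mulr_natr -[in leRHS](card_ord m) -sumr_const.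
  apply: ler_sum => i _; rewrite (_ : epsilon / 2 = 2 * (epsilon / 4)); last by field.
  apply: sqr_diff_le; rewrite ?bn_answer_01 ?empirical_cond_01 ?cond_true_01 //.
  by have := near2 i; rewrite -ltNge.
apply: le_lt_trans (ler_distD (m%:R^-1 * \sum_(i < m) Z (s i)) _ _) _.
by rewrite [ltRHS]splitr ler_ltD.
Qed.
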